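(* Let $V$ be the $9$-dimensional $\mathbb F_3$-vector space with basis $e_1,\ldots,e_9$ and let $q:V\to\Lambda^2V$ be the $\mathbb F_3$-linear relation map given explicitly in the context. Then the only subspaces $U\leq V$ such that $q(U)\subseteq\Lambda^2U$ are $U=0$ and $U=V$.
   Context: Here $\Lambda^2U$ is regarded as a subspace of $\Lambda^2V$ via the inclusion $U\leq V$. The linear map $q:V\to\Lambda^2V$ is defined on the basis by \begin{align*} q(e_1)&=e_2\wedge e_3+e_4\wedge e_5+e_6\wedge e_7+e_8\wedge e_9,\\ q(e_2)&=e_1\wedge e_3+e_4\wedge e_6+e_5\wedge e_8+e_7\wedge e_9,\\ q(e_3)&=e_1\wedge e_2+e_4\wedge e_7+e_5\wedge e_9+e_6\wedge e_8,\\ q(e_4)&=e_1\wedge e_5+e_2\wedge e_6+e_3\wedge e_9+e_7\wedge e_8,\\ q(e_5)&=e_1\wedge e_4+e_2\wedge e_8+e_3\wedge e_7+e_6\wedge e_9,\\ q(e_6)&=e_1\wedge e_7+e_2\wedge e_9+e_3\wedge e_5+e_4\wedge e_8,\\ q(e_7)&=e_1\wedge e_8+e_4\wedge e_9+e_3\wedge e_6+e_2\wedge e_5,\\ q(e_8)&=e_1\wedge e_9+e_3\wedge e_4+e_2\wedge e_7+e_5\wedge e_6,\\ q(e_9)&=e_1\wedge e_6+e_3\wedge e_8+e_2\wedge e_4+e_5\wedge e_7. \end{align*} (This is the relation map attached to a certain $9$-generator $3$-group $P$, with $V=P/\Phi(P)$; only the explicit formula is needed for the statement.) *)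

(* Defs.v *)
From HB Require Import structures.
From mathcomp Require Import all_boot all_order all_algebra.
From mathcomp Require Import sesquilinear ring.

Set Implicit Arguments.
Unset Strict Implicit.
Unset Printing Implicit Defensive.

Import GRing.Theory.
Local Open Scope ring_scope.

(* (W, wedge) is an exterior square of V: wedge is the universal alternating
   bilinear map out of V x V. Such a pair is unique up to isomorphism, and
   [ext2_exists] below shows that one always exists. *)
Definition is_ext2 (K : fieldType) (V W : vectType K)
    (wedge : {bilinear V -> V -> W}) : Prop :=
  (forall v, wedge v v = 0) /\
  (forall (X : vectType K) (f : {bilinear V -> V -> X}),
     (forall v, f v v = 0) ->
     exists! phi : 'Hom(W, X), forall u v, phi (wedge u v) = f u v).

(* The image of the exterior square of U in that of V, i.e. the span of the
   u /\ u' for u, u' in U; by bilinearity a basis of U suffices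
   ([memv_ext2_sub]). *)
Definition ext2_sub (K : fieldType) (V W : vectType K)
    (wedge : {bilinear V -> V -> W}) (U : {vspace V}) : {vspace W} :=
  <<[seq wedge u v | u <- vbasis U, v <- vbasis U]>>%VS.

Lemma memv_ext2_sub (K : fieldType) (V W : vectType K)
    (wedge : {bilinear V -> V -> W}) (U : {vspace V}) (u v : V) :
  u \in U -> v \in U -> wedge u v \in ext2_sub wedge U.
Proof.
move=> /coord_vbasis -> /coord_vbasis ->.
rewrite linear_sumlz; apply: memv_suml => i _.
rewrite linear_sumr; apply: memv_suml => j _.
rewrite linearZr_LR linearZl_LR; do 2!apply: memvZ.
by apply/memv_span/allpairs_f; apply: mem_nth; rewrite size_tuple.
Qed.

(* Existence, using coordinates on the vectors b_i /\ b_j with i < j. *)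
Section Ext2Exists.

Variables (K : fieldType) (V : vectType K).

Let n := \dim {:V}.
Let b : n.-tuple V := vbasis {:V}.
Let lt_pair : {pred 'I_n * 'I_n} := [pred p : 'I_n * 'I_n | (p.1 < p.2)%N].
Let W : vectType K := {ffun {p in lt_pair} -> K^o}.
Let c i (v : V) : K := coord b i v.

Let wf (u v : V) : W :=
  [ffun p => c (val p).1 u * c (val p).2 v - c (val p).2 u * c (val p).1 v].

Let wf_bilinear : bilinear_for *:%R *:%R wf.
Proof.
have cP i (a : K) (u v : V) : c i (a *: u + v) = a * c i u + c i v.
  exact: linearP.
by split=> z a u v; apply/ffunP=> p; rewrite !ffunE !cP /GRing.scale /=;
  move: (c _ _) (c _ _) (c _ _) (c _ _) (c _ _) (c _ _) => *; ring.
Qed.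

HB.instance Definition _ := bilinear_isBilinear.Build K V V W *:%R *:%R wf wf_bilinear.

Lemma ext2_exists :
  exists (W : vectType K) (wedge : {bilinear V -> V -> W}), is_ext2 wedge.
Proof.
exists W, wf; split=> [v|X f f0].
  by apply/ffunP=> p; rewrite !ffunE mulrC subrr.
have fC u v : f u v = - f v u.
  apply/eqP; rewrite -addr_eq0; move: (f0 (u + v)).
  by rewrite linearDl !linearDr !f0 add0r addr0 => ->.
pose g (p : 'I_n * 'I_n) := f b`_p.1 b`_p.2.
pose phi (x : W) : X := \sum_p x p *: g (val p).
have phi_lin : linear phi.
  move=> a x y; rewrite scaler_sumr -big_split; apply: eq_bigr => p _ /=.
  by rewrite !ffunE scalerDl scalerA.
pose phiL : {linear W -> X} := HB.pack phi (GRing.isLinear.Build _ _ _ _ phi phi_lin).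
exists (linfun phiL); split=> [u v|psi psiP].
  rewrite lfunE /= /phi.
  transitivity (\sum_(p : 'I_n * 'I_n) (c p.1 u * c p.2 v) *: g p).
    pose h (p : 'I_n * 'I_n) := c p.1 u * c p.2 v.
    pose sw (p : 'I_n * 'I_n) := (p.2, p.1).
    have swK : involutive sw by case.
    transitivity (\sum_(p in lt_pair) (h p *: g p + h (sw p) *: g (sw p))).
      rewrite [RHS]big_sub; apply: eq_bigr => p _.
      by rewrite ffunE scalerBl [g (sw _)]fC scalerN.
    rewrite big_split [RHS](bigID (mem lt_pair)) /=; congr (_ + _).
    rewrite [RHS](reindex_inj (inv_inj swK)) [RHS](bigID (mem lt_pair)) /=.
    rewrite [X in _ = _ + X]big1 ?addr0 => [|[i j]].
      apply: eq_bigl => p; rewrite !inE /= -leqNgt.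
      by case: ltnP => [/ltnW->|]; rewrite ?andbF.
    rewrite !inE /= -!leqNgt -eqn_leq => /eqP/val_inj ->.
    by rewrite /g f0 scaler0.
  rewrite -(pair_bigA _ (fun i j => (c i u * c j v) *: f b`_i b`_j)) /=.
  rewrite {2}(coord_vbasis (memvf u)) {2}(coord_vbasis (memvf v)) linear_sumlz.
  apply: eq_bigr => i _; rewrite linear_sumr; apply: eq_bigr => j _.
  by rewrite linearZl_LR linearZr_LR scalerA.
apply/lfunP => x; rewrite lfunE /= /phi.
have {2}-> : x = \sum_p x p *: (wf b`_(val p).1 b`_(val p).2 : W).
  have cb i (j : 'I_n) : c i b`_j = (j == i)%:R :> K.
    exact/coord_free/basis_free/vbasisP.
  apply/ffunP=> q; rewrite sum_ffunE (bigD1 q) //= big1 => [|p ne_pq].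
    rewrite !ffunE !cb !eqxx -!val_eqE /= (ltn_eqF (valP q)) mul0r subr0.
    by rewrite mulr1 addr0 [RHS]mulr1.
  rewrite !ffunE !cb -!val_eqE /=.
  case: p q ne_pq => [[i j] /= ij] [[k l] /= kl] ne_pq.
  have /negPf ne : ~~ ((i == k) && (j == l)) := ne_pq.
  have -> : (i == k)%:R * (j == l)%:R = 0 :> K by rewrite -natrM mulnb ne.
  have -> : (i == l)%:R * (j == k)%:R = 0 :> K.
    rewrite -natrM mulnb; case: eqP => //= il; case: eqP => //= jk.
    by move: (ij) (kl); rewrite il jk !inE /= ltnNge => /negP[]; apply: ltnW.
  by rewrite subrr scaler0.
rewrite linear_sum; apply: eq_bigr => p _.
by rewrite linearZ /= psiP.
Qed.

End Ext2Exists.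

Section RelationMap.

Variables (K : fieldType) (V W : vectType K).
Variables (wedge : {bilinear V -> V -> W}) (b : 9.-tuple V).

(* The basis vectors are numbered from 1. *)
Definition basis_vec (i : nat) : V := b`_i.-1.
Definition basis_wedge (i j : nat) : W := wedge (basis_vec i) (basis_vec j).

Local Notation e := basis_vec.
Local Notation w := basis_wedge.

Definition is_relation_map (q : 'Hom(V, W)) : Prop :=
     q (e 1) = w 2 3 + w 4 5 + w 6 7 + w 8 9
  /\ q (e 2) = w 1 3 + w 4 6 + w 5 8 + w 7 9
  /\ q (e 3) = w 1 2 + w 4 7 + w 5 9 + w 6 8
  /\ q (e 4) = w 1 5 + w 2 6 + w 3 9 + w 7 8
  /\ q (e 5) = w 1 4 + w 2 8 + w 3 7 + w 6 9
  /\ q (e 6) = w 1 7 + w 2 9 + w 3 5 + w 4 8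
  /\ q (e 7) = w 1 8 + w 4 9 + w 3 6 + w 2 5
  /\ q (e 8) = w 1 9 + w 3 4 + w 2 7 + w 5 6
  /\ q (e 9) = w 1 6 + w 3 8 + w 2 4 + w 5 7.

Lemma relation_map_exists (bP : basis_of fullv b) :
  exists q, is_relation_map q.
Proof.
pose r := [:: w 2 3 + w 4 5 + w 6 7 + w 8 9; w 1 3 + w 4 6 + w 5 8 + w 7 9;
  w 1 2 + w 4 7 + w 5 9 + w 6 8; w 1 5 + w 2 6 + w 3 9 + w 7 8;
  w 1 4 + w 2 8 + w 3 7 + w 6 9; w 1 7 + w 2 9 + w 3 5 + w 4 8;
  w 1 8 + w 4 9 + w 3 6 + w 2 5; w 1 9 + w 3 4 + w 2 7 + w 5 6;
  w 1 6 + w 3 8 + w 2 4 + w 5 7].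
have [f fP] := linear_of_free b r; exists (linfun f).
have {}fP i : (i < 9)%N -> linfun f (e i.+1) = r`_i.
  move=> lti; rewrite lfunE /= /basis_vec /=.
  by rewrite -(nth_map 0 0 f) ?size_tuple // fP ?size_tuple ?(basis_free bP).
by do !split; rewrite fP.
Qed.

End RelationMap.

(* Main.v *)
Require Import Defs.
From mathcomp Require Import all_boot all_order all_algebra.
From mathcomp Require Import sesquilinear.
From HB Require Import structures.

Import GRing.Theory.
Local Open Scope ring_scope.

(** For a linear functional f on V, let i_f : /\^2 V -> V be the contraction
    u /\ v |-> f(u) v - f(v) u, and put T_f = i_f o q.  If q(U) lies in
    /\^2 U, then every T_f maps U to itself, because i_f maps /\^2 U to U
    ([contraction_ext2_sub]).  So it is enough that V is irreducible under the
    operators T_f, and the proof of this is an instance of Norton's criterion.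

    Let x_k be the coordinate functionals, and T = T_{x_1}.  No term of q(e_1)
    contains e_1, and for i > 1 exactly one term of q(e_i) does, so T kills e_1
    and, from the formulas, permutes e_2, ..., e_9 with cycles (2 3), (4 5),
    (6 7 8 9).  Hence ker T is the line of e_1 ([contraction1_ker]), and there
    are two cases.

    - If e_1 is in U, then U contains the contractions of
      q(e_1) = e_2 /\ e_3 + e_4 /\ e_5 + e_6 /\ e_7 + e_8 /\ e_9, which are
      e_2, ..., e_9 up to sign, so U = V ([stable_eq_full]).

    - Otherwise T is injective on U, and U = 0 ([contraction_inj_stable_eq0]):
      by dimension T(U) = U, and x_1 vanishes on the image of i_{x_1}, thus on
      U.  Contractions are antisymmetric, g(i_f w) = - f(i_g w), so that
      g(T u) = - x_1(T_g u) = 0 for all u in U and all g.  Then T u = 0 and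
      u = 0.

    The argument works over every field. *)

(** * Contractions of bivectors *)

Section Contraction.

Set Implicit Arguments.
Unset Strict Implicit.

Context {K : fieldType} {V W : vectType K} (wedge : {bilinear V -> V -> W}).

Definition is_contraction (f : {linear V -> K^o}) (phi : 'Hom(W, V)) : Prop :=
  forall u v, phi (wedge u v) = f u *: v - f v *: u.

Lemma contraction_exists (ext2W : is_ext2 wedge) (f : {linear V -> K^o}) :
  exists phi, is_contraction f phi.
Proof.
have [_ univ] := ext2W; pose g u v := f u *: v - f v *: u.
have g_bilinear : bilinear_for *:%R *:%R g.
  have fP a u v : f (a *: u + v) = a * f u + f v by apply: linearP.
  have gC u v : g u v = - g v u by rewrite /g opprB.
  have gP z a u v : g (a *: u + v) z = a *: g u z + g v z.
    by rewrite /g fP scalerBr scalerDl scalerDr !scalerA [f z * a]mulrC opprD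
      addrACA.
  split=> z a u v; first exact: gP.
  by rewrite /= gC gP opprD -scalerN -!gC.
pose gB : {bilinear V -> V -> V} :=
  HB.pack g (bilinear_isBilinear.Build K V V V *:%R *:%R g g_bilinear).
have [|phi [phiE _]] := univ V gB; first by move=> v; apply: subrr.
by exists phi.
Qed.

Lemma ext2_sub_ind (U : {vspace V}) (P : W -> Prop) :
  P 0 -> (forall a w w', P w -> P w' -> P (a *: w + w')) ->
  {in U &, forall u v, P (wedge u v)} ->
  {in ext2_sub wedge U, forall w, P w}.
Proof.
move=> P0 Plin Pwedge w.
set S := [seq wedge u v | u <- vbasis U, v <- vbasis U].
move/(coord_span (X := in_tuple S)) => ->.
elim/big_rec: _ => // i w' _; apply: Plin.
have /allpairsP[[u v] /= [Uu Uv ->]] := mem_nth 0 (ltn_ord i : i < size S)%N.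
by apply: Pwedge; apply: vbasis_mem.
Qed.

Lemma contraction_ext2_sub f phi (U : {vspace V}) :
  is_contraction f phi -> {in ext2_sub wedge U, forall w, phi w \in U}.
Proof.
move=> phiE; apply: ext2_sub_ind => [|a w w' Uw Uw'|u v Uu Uv].
- by rewrite linear0 mem0v.
- by rewrite linearP memvD ?memvZ.
- by rewrite phiE memvB ?memvZ.
Qed.

Lemma functional_contraction f (g : {linear V -> K^o}) phi u v :
  is_contraction f phi -> g (phi (wedge u v)) = f u * g v - f v * g u.
Proof. by move->; rewrite linearB !linearZ. Qed.

Lemma contraction_self f phi (U : {vspace V}) :
  is_contraction f phi -> {in ext2_sub wedge U, forall w, f (phi w) = 0}.
Proof.
move=> phiE; apply: ext2_sub_ind => [|a w w' fw fw'|u v _ _].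
- by rewrite !linear0.
- by rewrite !linearP /= fw fw' scaler0 addr0.
- by rewrite (functional_contraction _ _ _ phiE) mulrC subrr.
Qed.

Lemma contraction_antisym f g phi psi (U : {vspace V}) :
  is_contraction f phi -> is_contraction g psi ->
  {in ext2_sub wedge U, forall w, g (phi w) = - f (psi w)}.
Proof.
move=> phiE psiE; apply: ext2_sub_ind => [|a w w' gw gw'|u v _ _].
- by rewrite !linear0.
- by rewrite !linearP /= gw gw'.
- rewrite !(functional_contraction _ _ _ phiE, functional_contraction _ _ _ psiE).
  by rewrite opprB mulrC [g u * _]mulrC.
Qed.

(** This is the dual half of Norton's criterion.  With T = phi o q, the equality
    U = T(U) puts f in the annihilator of U, and the operators psi o q, for psi
    the contraction by any g, leave U stable.  So f o psi o q is also 0 on U; by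
    antisymmetry this is - g o T, hence T is 0 on U. *)
Lemma contraction_inj_stable_eq0 (q : 'Hom(V, W)) f phi (U : {vspace V}) :
  is_ext2 wedge -> is_contraction f phi -> (q @: U <= ext2_sub wedge U)%VS ->
  {in U, forall u, phi (q u) = 0 -> u = 0} -> U = 0%VS.
Proof.
move=> ext2W phiE qU injU.
have Uq u : u \in U -> q u \in ext2_sub wedge U.
  by move=> Uu; apply: (subvP qU); apply: memv_img.
have TU : ((phi \o q)%VF @: U = U)%VS.
  apply/eqP; rewrite eqEdim limg_dim_eq ?leqnn ?andbT.
    apply/subvP=> _ /memv_imgP[u Uu ->]; rewrite lfunE /=.
    exact: contraction_ext2_sub phiE _ (Uq u Uu).
  apply/eqP; rewrite -subv0; apply/subvP=> u.
  rewrite memv_cap memv_ker lfunE /= => /andP[Uu /eqP/(injU u Uu)->].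
  exact: mem0v.
have fU u : u \in U -> f u = 0.
  rewrite -TU => /memv_imgP[v Uv ->]; rewrite lfunE /=.
  exact: contraction_self phiE _ (Uq v Uv).
apply/eqP; rewrite -subv0; apply/subvP=> u Uu; rewrite memv0; apply/eqP.
apply: injU => //; rewrite (coord_vbasis (memvf (phi (q u)))).
apply: big1 => i _.
have [psi psiE] := contraction_exists ext2W (coord (vbasis {:V}) i).
have -> : coord (vbasis {:V}) i (phi (q u)) = 0.
  rewrite (contraction_antisym phiE psiE (Uq u Uu)) fU ?oppr0 //.
  exact: contraction_ext2_sub psiE _ (Uq u Uu).
exact: scale0r.
Qed.

End Contraction.

(** * The relation map *)

Section RelationMap.

Set Implicit Arguments.
Unset Strict Implicit.

Context {K : fieldType} {V W : vectType K} {wedge : {bilinear V -> V -> W}}.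
Context {e : 9.-tuple V} (eP : basis_of fullv e).
Context {q : 'Hom(V, W)} (qP : is_relation_map wedge e q).

Lemma contraction_basis_wedge (k : 'I_9) phi a b :
  is_contraction wedge (coord e k) phi -> (a < 9)%N -> (b < 9)%N ->
  phi (basis_wedge wedge e a.+1 b.+1) =
    (a == k :> nat)%:R *: e`_b - (b == k :> nat)%:R *: e`_a.
Proof.
move=> phiE lta ltb; rewrite phiE /basis_vec /=.
have eF := basis_free eP.
by rewrite (coord_free (Ordinal lta) k eF) (coord_free (Ordinal ltb) k eF)
  -!val_eqE.
Qed.

(** The indices of [e`_i] start from 0, so [e`_0] is e_1.  The image of e_i is
    the partner of e_1 in q(e_i), always with sign + because e_1 is the left
    factor of every such term. *)
Lemma contraction1_basis phi :
  is_contraction wedge (coord e ord0) phi ->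
  [seq phi (q v) | v <- e]
    = [:: 0; e`_2; e`_1; e`_4; e`_3; e`_6; e`_7; e`_8; e`_5].
Proof.
move=> phiE; apply: (@eq_from_nth _ 0); rewrite size_map size_tuple // => i lti.
rewrite (nth_map 0) ?size_tuple //.
have [q1 [q2 [q3 [q4 [q5 [q6 [q7 [q8 q9]]]]]]]] := qP.
rewrite /basis_vec /= in q1 q2 q3 q4 q5 q6 q7 q8 q9.
do 9?[case: i lti => [|i] lti] => //=;
  rewrite ?(q1, q2, q3, q4, q5, q6, q7, q8, q9) !linearD /=;
  by rewrite !(contraction_basis_wedge phiE) //=
    ?(scale0r, scale1r, oppr0, addr0, add0r).
Qed.

Lemma contraction1_ker phi u :
  is_contraction wedge (coord e ord0) phi ->
  phi (q u) = 0 -> u = coord e ord0 u *: e`_0.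
Proof.
move=> phiE Tu0; pose T := (phi \o q)%VF.
have Tnth i : (i < 9)%N -> T e`_i =
    [:: 0; e`_2; e`_1; e`_4; e`_3; e`_6; e`_7; e`_8; e`_5]`_i.
  move=> lti; rewrite lfunE -(contraction1_basis phiE).
  by rewrite (nth_map 0) ?size_tuple.
(* The fourth power, because (2 3)(4 5)(6 7 8 9) has order 4. *)
have T4 v : T (T (T (T v))) = v - coord e ord0 v *: e`_0.
  have {1 2}-> := coord_basis eP (memvf v).
  rewrite !linear_sum [LHS]big_ord_recl [in RHS]big_ord_recl /=.
  rewrite [RHS]addrAC subrr [RHS]add0r !linearZ /= (Tnth 0%N) // !linear0.
  rewrite add0r; apply: eq_bigr => i _; rewrite !linearZ /=.
  congr (_ *: _); case: i => i lti /=; rewrite /bump add1n.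
  by do 8?[case: i lti => [|i] lti]; rewrite ?Tnth.
apply/eqP; rewrite -subr_eq0 -T4 [T u]lfunE /= Tu0.
by rewrite !linear0.
Qed.

Lemma stable_eq_full (U : {vspace V}) :
  is_ext2 wedge -> (q @: U <= ext2_sub wedge U)%VS -> e`_0 \in U -> U = fullv.
Proof.
move=> ext2W qU Ue1; apply/eqP; rewrite eqEsubv subvf /= -(span_basis eP).
have qe1 : q e`_0 \in ext2_sub wedge U by apply: (subvP qU); apply: memv_img.
have [q1 _] := qP; rewrite /basis_vec /= in q1.
have Uk k phi : is_contraction wedge (coord e k) phi -> phi (q e`_0) \in U.
  by move/contraction_ext2_sub; apply.
apply/span_subvP=> _ /(nthP 0)[m ltm <-]; rewrite size_tuple in ltm.
(* The contraction by the coordinate of e_i sends q(e_1) to the partner of e_i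
   in q(e_1), up to sign; the list gives the partners.  Its entry at 0 is
   arbitrary, since e_1 is already known to be in U. *)
pose k : 'I_9 := inord (nth 0 [:: 0; 2; 1; 4; 3; 6; 5; 8; 7] m)%N.
have [phi phiE] := contraction_exists ext2W (coord e k).
move: (Uk _ _ phiE); rewrite q1 !linearD /= !(contraction_basis_wedge phiE) //=.
rewrite /k {phiE k}; do 9?[case: m ltm => [|m] ltm] => //;
  rewrite ?inordK //= ?(scale0r, scale1r, oppr0, addr0, add0r) //.
all: by rewrite memvN.
Qed.

Lemma relation_map_full : (q @: fullv <= ext2_sub wedge fullv)%VS.
Proof.
rewrite -(span_basis eP) limg_span.
apply/span_subvP=> _ /mapP[_ /(nthP 0)[i lti <-] ->].
rewrite size_tuple in lti; rewrite (span_basis eP).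
have [q1 [q2 [q3 [q4 [q5 [q6 [q7 [q8 q9]]]]]]]] := qP.
rewrite /basis_vec /= in q1 q2 q3 q4 q5 q6 q7 q8 q9.
do 9?[case: i lti => [|i] lti] => //;
  rewrite ?(q1, q2, q3, q4, q5, q6, q7, q8, q9);
  by rewrite !memvD // memv_ext2_sub ?memvf.
Qed.

Theorem relation_map_stableP (U : {vspace V}) :
  is_ext2 wedge ->
  (q @: U <= ext2_sub wedge U)%VS <-> U = 0%VS \/ U = fullv.
Proof.
move=> ext2W; split=> [qU|[->|->]].
- have [Ue1|nUe1] := boolP (e`_0 \in U); first by right; apply: stable_eq_full.
  left; have [phi phiE] := contraction_exists ext2W (coord e ord0).
  apply: (contraction_inj_stable_eq0 ext2W phiE qU) => u Uu.
  move/(contraction1_ker phiE) => uE.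
  rewrite uE rpredZeq (negPf nUe1) orbF in Uu.
  by rewrite uE (eqP Uu) scale0r.
- by rewrite limg0 sub0v.
- exact: relation_map_full.
Qed.

End RelationMap.

Theorem theorem1p2
  (V W : vectType 'F_3) (wedge : {bilinear V -> V -> W})
  (hW : is_ext2 wedge)
  (e : 9.-tuple V) (he : basis_of fullv e)
  (q : 'Hom(V, W)) (hq : is_relation_map wedge e q)
  (U : {vspace V}) :
  (q @: U <= ext2_sub wedge U)%VS <-> U = 0%VS \/ U = fullv.
Proof. exact (relation_map_stableP he hq U hW). Qed.
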